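(* Let $\Bbbk$ be a field, $q\in\Bbbk$, and let $\mathbf{h}$ be a finite-dimensional connected $q$-Hopf monoid. Let $\mathsf{O}_{\mathbf{h}}(x)=\sum_{n\ge 0}\dim_\Bbbk\mathbf{h}[n]\,x^n$ be its ordinary generating function. Then $$1-\frac{1}{\mathsf{O}_{\mathbf{h}}(x)}\in\mathbb{N}[\![x]\!],$$ that is, all the coefficients of this formal power series are nonnegative integers.
   Context: **Species.** Fix a field $\Bbbk$. A species is a functor from the category of finite sets and bijections to the category of $\Bbbk$-vector spaces; morphisms are natural transformations. $\mathbf{p}[n]$ denotes $\mathbf{p}[\{1,\dots,n\}]$. A species $\mathbf{p}$ is finite-dimensional if each $\mathbf{p}[n]$, $n\ge0$, is finite-dimensional, and connected if $\dim_\Bbbk\mathbf{p}[\emptyset]=1$. $I=S\sqcup T$ means $I=S\cup T$ and $S\cap T=\emptyset$ (ordered pair, parts possibly empty). $\mathbb{N}$ is the set of nonnegative integers. **Monoids and comonoids.** A monoid (in species) is a species $\mathbf{p}$ with linear maps $\mu_{S,T}:\mathbf{p}[S]\otimes\mathbf{p}[T]\to\mathbf{p}[I]$, one for each $I=S\sqcup T$, natural with respect to bijections of $I$, and a linear map $\iota_\emptyset:\Bbbk\to\mathbf{p}[\emptyset]$, which are associative ($\mu_{R\sqcup S,T}(\mu_{R,S}\otimes\mathrm{id})=\mu_{R,S\sqcup T}(\mathrm{id}\otimes\mu_{S,T})$) and unital ($\mu_{\emptyset,I}(\iota_\emptyset\otimes\mathrm{id})=\mathrm{id}=\mu_{I,\emptyset}(\mathrm{id}\otimes\iota_\emptyset)$).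 Dually, a comonoid has natural maps $\Delta_{S,T}:\mathbf{p}[I]\to\mathbf{p}[S]\otimes\mathbf{p}[T]$ and $\epsilon_\emptyset:\mathbf{p}[\emptyset]\to\Bbbk$, coassociative and counital. **$q$-bimonoids and $q$-Hopf monoids.** For $q\in\Bbbk$ (possibly zero), a $q$-bimonoid is a species $\mathbf{h}$ which is a monoid and a comonoid such that (i) for any $I=S\sqcup T=S'\sqcup T'$, with $A=S\cap S'$, $B=S\cap T'$, $C=T\cap S'$, $D=T\cap T'$, $$\Delta_{S',T'}\,\mu_{S,T}=(\mu_{A,C}\otimes\mu_{B,D})(\mathrm{id}\otimes\beta_q\otimes\mathrm{id})(\Delta_{A,B}\otimes\Delta_{C,D}),$$ where $\beta_q:\mathbf{h}[B]\otimes\mathbf{h}[C]\to\mathbf{h}[C]\otimes\mathbf{h}[B]$ is $x\otimes y\mapsto q^{|B||C|}\,y\otimes x$ (with $0^0=1$); and (ii) $\epsilon_\emptyset\iota_\emptyset=\mathrm{id}$, $\epsilon_\emptyset\mu_{\emptyset,\emptyset}=\epsilon_\emptyset\otimes\epsilon_\emptyset$, $\Delta_{\emptyset,\emptyset}\iota_\emptyset=\iota_\emptyset\otimes\iota_\emptyset$. A $q$-Hopf monoid is a $q$-bimonoid with an antipode, i.e. a morphism of species $s:\mathbf{h}\to\mathbf{h}$ such that for every $I$ both $\sum_{I=S\sqcup T}\mu_{S,T}(\mathrm{id}\otimes s_T)\Delta_{S,T}$ and $\sum_{I=S\sqcup T}\mu_{S,T}(s_S\otimes\mathrm{id})\Delta_{S,T}$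 equal $\iota_\emptyset\epsilon_\emptyset$ if $I=\emptyset$ and $0$ if $I\ne\emptyset$. (A connected $q$-bimonoid is automatically a $q$-Hopf monoid.) *)

(* Defs.v *)
From HB Require Import structures.
From mathcomp Require Import all_boot all_order all_algebra.

Set Implicit Arguments.
Unset Strict Implicit.
Unset Printing Implicit Defensive.

Import GRing.Theory.
Local Open Scope ring_scope.

(** * Tensor products of finite-dimensional vector spaces *)

(** [tens V W] is the space of coordinates with respect to the products of the
    basis vectors of [vbasis {:V}] and [vbasis {:W}]; [tprod] is the universal
    bilinear map, as shown by [tlift_tprod] and [tens_ext] below. *)
Definition tens (K : fieldType) (V W : vectType K) : vectType K :=
  'M[K]_(\dim {:V}, \dim {:W}).

Definition tprod (K : fieldType) (V W : vectType K) (v : V) (w : W) :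
    tens V W :=
  \matrix_(i, j) (coord (vbasis {:V}) i v * coord (vbasis {:W}) j w).

(** The linear map induced by a bilinear map [f] (meaningful only when [f] is
    bilinear). *)
Definition tlift (K : fieldType) (V W X : vectType K) (f : V -> W -> X) :
    'Hom(tens V W, X) :=
  linfun (fun M : tens V W => \sum_i \sum_j
    (M : 'M[K]_(\dim {:V}, \dim {:W})) i j *: f (vbasis {:V})`_i (vbasis {:W})`_j).

Definition bilin (K : fieldType) (V W X : vectType K) (f : V -> W -> X) : Prop :=
  (forall w, linear (f^~ w)) /\ (forall v, linear (f v)).

Lemma tlift_sum (K : fieldType) (V W X : vectType K) (f : V -> W -> X) M :
  tlift f M = \sum_i \sum_j
    (M : 'M[K]_(\dim {:V}, \dim {:W})) i j *: f (vbasis {:V})`_i (vbasis {:W})`_j.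
Proof.
pose g (M : tens V W) : X := \sum_i \sum_j
  (M : 'M[K]_(\dim {:V}, \dim {:W})) i j *: f (vbasis {:V})`_i (vbasis {:W})`_j.
have g_lin : linear g.
  move=> a A B; rewrite /g scaler_sumr -big_split; apply: eq_bigr => i _ /=.
  rewrite scaler_sumr -big_split; apply: eq_bigr => j _ /=.
  by rewrite !mxE scalerDl scalerA.
pose gL := GRing.isLinear.Build K (tens V W) X _ g g_lin.
pose gl : {linear tens V W -> X} := HB.pack g gL.
by rewrite -[RHS]/(gl M) -(lfunE gl).
Qed.

Lemma bilin_tprod (K : fieldType) (V W : vectType K) : bilin (@tprod K V W).
Proof.
split=> [w a u v | v a u w]; apply/matrixP=> i j; rewrite !mxE linearP /=.
  by rewrite mulrDl mulrA.
by rewrite mulrDr mulrCA.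
Qed.

Lemma bilin_suml (K : fieldType) (V W X : vectType K) (f : V -> W -> X) :
  bilin f -> forall n (a : 'I_n -> K) (v : 'I_n -> V) w,
  f (\sum_i a i *: v i) w = \sum_i a i *: f (v i) w.
Proof.
move=> [fl _] n a v w.
pose gL := GRing.isLinear.Build K V X _ (f^~ w) (fl w).
pose g : {linear V -> X} := HB.pack (f^~ w) gL.
rewrite -[LHS]/(g _) linear_sum; apply: eq_bigr => i _.
by rewrite linearZ.
Qed.

Lemma bilin_sumr (K : fieldType) (V W X : vectType K) (f : V -> W -> X) :
  bilin f -> forall n (a : 'I_n -> K) v (w : 'I_n -> W),
  f v (\sum_i a i *: w i) = \sum_i a i *: f v (w i).
Proof.
move=> [fl fr] n a v w.
by apply: (@bilin_suml K W V X (fun w v => f v w)); split=> x; [exact: fr|exact: fl].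
Qed.

Lemma tlift_tprod (K : fieldType) (V W X : vectType K) (f : V -> W -> X) :
  bilin f -> forall v w, tlift f (tprod v w) = f v w.
Proof.
move=> fb v w; rewrite tlift_sum.
rewrite {2}(coord_vbasis (memvf v)) {2}(coord_vbasis (memvf w)).
rewrite (bilin_suml fb); apply: eq_bigr => i _.
rewrite (bilin_sumr fb) scaler_sumr; apply: eq_bigr => j _.
by rewrite mxE scalerA.
Qed.

Lemma tens_ext (K : fieldType) (V W X : vectType K) (f g : 'Hom(tens V W, X)) :
  (forall v w, f (tprod v w) = g (tprod v w)) -> f = g.
Proof.
move=> fg; apply/lfunP=> M.
suff -> : M = \sum_i \sum_j (M : 'M[K]_(\dim {:V}, \dim {:W})) i j *:
    tprod (vbasis {:V})`_i (vbasis {:W})`_j.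
  rewrite !linear_sum; apply: eq_bigr => i _; rewrite !linear_sum.
  by apply: eq_bigr => j _; rewrite !linearZ /= fg.
rewrite [LHS]matrix_sum_delta; apply: eq_bigr => i _; apply: eq_bigr => j _.
congr (_ *: _); apply/matrixP=> k l; rewrite !mxE.
rewrite !coord_free ?(basis_free (vbasisP _)) //.
by rewrite (eq_sym k) (eq_sym l); do 2!case: (_ == _); rewrite /= ?mulr1 ?mulr0.
Qed.

Definition tmap (K : fieldType) (V V' W W' : vectType K)
    (f : 'Hom(V, V')) (g : 'Hom(W, W')) : 'Hom(tens V W, tens V' W') :=
  tlift (fun v w => tprod (f v) (g w)).

Definition tassoc (K : fieldType) (U V W : vectType K) :
    'Hom(tens (tens U V) W, tens U (tens V W)) :=
  tlift (fun t w => tlift (fun u v => tprod u (tprod v w)) t).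

Definition tassoc_inv (K : fieldType) (U V W : vectType K) :
    'Hom(tens U (tens V W), tens (tens U V) W) :=
  tlift (fun u t => tlift (fun v w => tprod (tprod u v) w) t).

(** The canonical isomorphism from the tensor product of [K] with [V] to [V],
    and its mirror image. *)
Definition tunitl (K : fieldType) (V : vectType K) : 'Hom(tens K^o V, V) :=
  tlift (fun (a : K^o) v => (a : K) *: v).

Definition tunitr (K : fieldType) (V : vectType K) : 'Hom(tens V K^o, V) :=
  tlift (fun v (a : K^o) => (a : K) *: v).

Definition tswap (K : fieldType) (c : K) (V W : vectType K) :
    'Hom(tens V W, tens W V) :=
  tlift (fun v w => c *: tprod w v).

(** "id (x) b (x) id" on a fourfold tensor product, with its associators. *)
Definition tmiddle (K : fieldType) (U V V' W W' X : vectType K)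
    (b : 'Hom(tens V W, tens W' V')) :
    'Hom(tens (tens U V) (tens W X), tens (tens U W') (tens V' X)) :=
  (tassoc_inv U W' (tens V' X)
   \o (tmap \1 (tassoc W' V' X \o (tmap b \1 \o tassoc_inv V W X))
   \o tassoc U V (tens W X)))%VF.

Lemma tmapE (K : fieldType) (V V' W W' : vectType K)
    (f : 'Hom(V, V')) (g : 'Hom(W, W')) v w :
  tmap f g (tprod v w) = tprod (f v) (g w).
Proof.
case: (bilin_tprod V' W') => bl br.
by rewrite tlift_tprod //; split=> [x|x] a y z; rewrite linearP (bl, br).
Qed.

Lemma tassocE (K : fieldType) (U V W : vectType K) (u : U) (v : V) (w : W) :
  tassoc U V W (tprod (tprod u v) w) = tprod u (tprod v w).
Proof.
case: (bilin_tprod V W) => bl br; case: (bilin_tprod U (tens V W)) => cl cr.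
have b1 x : bilin (fun u v => tprod (u : U) (tprod (v : V) (x : W))).
  by split=> y a z t; rewrite ?bl (cl, cr).
rewrite tlift_tprod ?tlift_tprod //; split=> [x a s t|t a x y].
  by rewrite linearP.
rewrite !tlift_sum scaler_sumr -big_split; apply: eq_bigr => i _.
rewrite scaler_sumr -big_split; apply: eq_bigr => j _ /=.
by rewrite br cr scalerDr !scalerA mulrC.
Qed.

Lemma tassoc_invE (K : fieldType) (U V W : vectType K) (u : U) (v : V) (w : W) :
  tassoc_inv U V W (tprod u (tprod v w)) = tprod (tprod u v) w.
Proof.
case: (bilin_tprod U V) => bl br; case: (bilin_tprod (tens U V) W) => cl cr.
have b1 x : bilin (fun v w => tprod (tprod (x : U) (v : V)) (w : W)).
  by split=> y a z t; rewrite ?br (cl, cr).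
rewrite tlift_tprod ?tlift_tprod //; split=> [t a x y|x a s t].
  rewrite !tlift_sum scaler_sumr -big_split; apply: eq_bigr => i _.
  rewrite scaler_sumr -big_split; apply: eq_bigr => j _ /=.
  by rewrite bl cl scalerDr !scalerA mulrC.
by rewrite linearP.
Qed.

Lemma tunitlE (K : fieldType) (V : vectType K) (a : K^o) (v : V) :
  tunitl V (tprod a v) = (a : K) *: v.
Proof.
rewrite tlift_tprod //; split=> [w c x y|x c y z].
  by rewrite scalerDl scalerA.
by rewrite scalerDr !scalerA mulrC.
Qed.

Lemma tunitrE (K : fieldType) (V : vectType K) (a : K^o) (v : V) :
  tunitr V (tprod v a) = (a : K) *: v.
Proof.
rewrite tlift_tprod //; split=> [x c y z|w c x y].
  by rewrite scalerDr !scalerA mulrC.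
by rewrite scalerDl scalerA.
Qed.

Lemma tswapE (K : fieldType) (c : K) (V W : vectType K) (v : V) (w : W) :
  tswap c V W (tprod v w) = c *: tprod w v.
Proof.
case: (bilin_tprod W V) => bl br.
by rewrite tlift_tprod //; split=> x a y z; rewrite (bl, br) scalerDr !scalerA mulrC.
Qed.

(** * Species *)

Record bij (I J : Type) := Bij { bij_fun :> I -> J; bij_funP : bijective bij_fun }.

(** Finite-dimensional species.  Functoriality makes every [p I] isomorphic to
    some [p 'I_n], so finite-dimensionality of the [p 'I_n] amounts to taking
    values in [vectType].  The laws are stated up to pointwise equality of
    bijections; in particular pointwise equal bijections act equally. *)
Record species (K : fieldType) := Species {
  sp_obj :> finType -> vectType K;
  sp_map : forall I J : finType, bij I J -> 'Hom(sp_obj I, sp_obj J);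
  sp_map_id : forall (I : finType) (s : bij I I), s =1 id -> sp_map s = \1%VF;
  sp_map_comp : forall (I J L : finType) (s : bij I J) (t : bij J L) (u : bij I L),
    u =1 t \o s -> sp_map u = (sp_map t \o sp_map s)%VF
}.

Definition sp_connected (K : fieldType) (p : species K) : Prop :=
  \dim {:p void} = 1%N.

(** Finite sets with decompositions are handled as subsets of an arbitrary
    ambient finite type [U], each regarded as a finite type of its own. *)
Definition subft (U : finType) (S : {set U}) : finType := {x : U | x \in S}.

Definition is_decomp (U : finType) (I S T : {set U}) : bool :=
  (I == S :|: T) && [disjoint S & T].

(** [s1 : S -> S'] is the restriction of [s : I -> J]. *)
Definition restricts (U V : finType) (I S : {set U}) (J S' : {set V})
    (s : bij (subft I) (subft J)) (s1 : bij (subft S) (subft S')) : Prop :=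
  forall (x : subft S) (y : subft I), val x = val y -> val (s1 x) = val (s y).

(** * Monoids, comonoids and q-Hopf monoids *)

Record sp_monoid (K : fieldType) (p : species K) := SpMonoid {
  mon_mu : forall (U : finType) (I S T : {set U}), is_decomp I S T ->
    'Hom(tens (p (subft S)) (p (subft T)), p (subft I));
  (* every ambient type has its own copy of the empty set; by naturality the
     maps [mon_iota U] are determined by any one of them *)
  mon_iota : forall U : finType, 'Hom(K^o, p (subft (set0 : {set U})));
  mon_mu_nat : forall (U V : finType) (I S T : {set U}) (J S' T' : {set V})
    (d : is_decomp I S T) (d' : is_decomp J S' T')
    (s : bij (subft I) (subft J)) (s1 : bij (subft S) (subft S')) (s2 : bij (subft T) (subft T')),
    restricts s s1 -> restricts s s2 ->
    (sp_map p s \o mon_mu d)%VF = (mon_mu d' \o tmap (sp_map p s1) (sp_map p s2))%VF;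
  mon_iota_nat : forall (U V : finType)
    (s : bij (subft (set0 : {set U})) (subft (set0 : {set V}))),
    (sp_map p s \o mon_iota U)%VF = mon_iota V;
  mon_mu_assoc : forall (U : finType) (I R S T RS ST : {set U})
    (dRS : is_decomp RS R S) (dRS_T : is_decomp I RS T)
    (dST : is_decomp ST S T) (dR_ST : is_decomp I R ST),
    (mon_mu dRS_T \o tmap (mon_mu dRS) \1)%VF = (mon_mu dR_ST \o (tmap \1 (mon_mu dST) \o tassoc _ _ _))%VF;
  mon_mu_unitl : forall (U : finType) (I : {set U}) (d : is_decomp I set0 I),
    (mon_mu d \o tmap (mon_iota U) \1)%VF = tunitl _;
  mon_mu_unitr : forall (U : finType) (I : {set U}) (d : is_decomp I I set0),
    (mon_mu d \o tmap \1 (mon_iota U))%VF = tunitr _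
}.

Record sp_comonoid (K : fieldType) (p : species K) := SpComonoid {
  com_Delta : forall (U : finType) (I S T : {set U}), is_decomp I S T ->
    'Hom(p (subft I), tens (p (subft S)) (p (subft T)));
  com_eps : forall U : finType, 'Hom(p (subft (set0 : {set U})), K^o);
  com_Delta_nat : forall (U V : finType) (I S T : {set U}) (J S' T' : {set V})
    (d : is_decomp I S T) (d' : is_decomp J S' T')
    (s : bij (subft I) (subft J)) (s1 : bij (subft S) (subft S')) (s2 : bij (subft T) (subft T')),
    restricts s s1 -> restricts s s2 ->
    (com_Delta d' \o sp_map p s)%VF = (tmap (sp_map p s1) (sp_map p s2) \o com_Delta d)%VF;
  com_eps_nat : forall (U V : finType)
    (s : bij (subft (set0 : {set U})) (subft (set0 : {set V}))),
    (com_eps V \o sp_map p s)%VF = com_eps U;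
  com_Delta_coassoc : forall (U : finType) (I R S T RS ST : {set U})
    (dRS : is_decomp RS R S) (dRS_T : is_decomp I RS T)
    (dST : is_decomp ST S T) (dR_ST : is_decomp I R ST),
    (tassoc _ _ _ \o (tmap (com_Delta dRS) \1 \o com_Delta dRS_T))%VF
      = (tmap \1 (com_Delta dST) \o com_Delta dR_ST)%VF;
  com_Delta_counitl : forall (U : finType) (I : {set U}) (d : is_decomp I set0 I),
    (tunitl _ \o (tmap (com_eps U) \1 \o com_Delta d))%VF = \1%VF;
  com_Delta_counitr : forall (U : finType) (I : {set U}) (d : is_decomp I I set0),
    (tunitr _ \o (tmap \1 (com_eps U) \o com_Delta d))%VF = \1%VF
}.

Record q_bimonoid_axioms (K : fieldType) (q : K) (h : species K)
    (m : sp_monoid h) (c : sp_comonoid h) : Prop := QBimonoidAxioms {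
  bim_compat : forall (U : finType) (I S T S' T' : {set U})
    (d : is_decomp I S T) (d' : is_decomp I S' T')
    (dAB : is_decomp S (S :&: S') (S :&: T')) (dCD : is_decomp T (T :&: S') (T :&: T'))
    (dAC : is_decomp S' (S :&: S') (T :&: S')) (dBD : is_decomp T' (S :&: T') (T :&: T')),
    (com_Delta c d' \o mon_mu m d)%VF =
    (tmap (mon_mu m dAC) (mon_mu m dBD)
     \o (tmiddle _ _ (tswap (q ^+ (#|S :&: T'| * #|T :&: S'|)) _ _)
     \o tmap (com_Delta c dAB) (com_Delta c dCD)))%VF;
  bim_eps_iota : forall U : finType, (com_eps c U \o mon_iota m U)%VF = \1%VF;
  bim_eps_mu : forall (U : finType) (d : is_decomp set0 set0 (set0 : {set U})),
    (com_eps c U \o mon_mu m d)%VF = (tunitl _ \o tmap (com_eps c U) (com_eps c U))%VF;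
  bim_Delta_iota : forall (U : finType) (d : is_decomp set0 set0 (set0 : {set U})),
    (com_Delta c d \o (mon_iota m U \o tunitl _))%VF = tmap (mon_iota m U) (mon_iota m U)
}.

(** The two sums below run over all ordered decompositions of [I]. *)
Definition conv_id_s (K : fieldType) (h : species K) (m : sp_monoid h) (c : sp_comonoid h)
    (s : forall I : finType, 'Hom(h I, h I)) (U : finType) (I : {set U}) :
    'Hom(h (subft I), h (subft I)) :=
  \sum_(d : {p : {set U} * {set U} | is_decomp I p.1 p.2})
    (mon_mu m (valP d) \o (tmap \1 (s _) \o com_Delta c (valP d)))%VF.

Definition conv_s_id (K : fieldType) (h : species K) (m : sp_monoid h) (c : sp_comonoid h)
    (s : forall I : finType, 'Hom(h I, h I)) (U : finType) (I : {set U}) :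
    'Hom(h (subft I), h (subft I)) :=
  \sum_(d : {p : {set U} * {set U} | is_decomp I p.1 p.2})
    (mon_mu m (valP d) \o (tmap (s _) \1 \o com_Delta c (valP d)))%VF.

Record antipode (K : fieldType) (h : species K) (m : sp_monoid h) (c : sp_comonoid h) :=
    Antipode {
  anti : forall I : finType, 'Hom(h I, h I);
  anti_nat : forall (I J : finType) (s : bij I J),
    (sp_map h s \o anti I)%VF = (anti J \o sp_map h s)%VF;
  anti_empty : forall U : finType,
    conv_id_s m c anti (set0 : {set U}) = (mon_iota m U \o com_eps c U)%VF /\
    conv_s_id m c anti (set0 : {set U}) = (mon_iota m U \o com_eps c U)%VF;
  anti_nonempty : forall (U : finType) (I : {set U}), I != set0 ->
    conv_id_s m c anti I = 0 /\ conv_s_id m c anti I = 0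
}.

Record q_hopf_monoid (K : fieldType) (q : K) := QHopfMonoid {
  hopf_species :> species K;
  hopf_monoid : sp_monoid hopf_species;
  hopf_comonoid : sp_comonoid hopf_species;
  hopf_bimonoid : q_bimonoid_axioms q hopf_monoid hopf_comonoid;
  hopf_antipode : antipode hopf_monoid hopf_comonoid
}.

(** * Formal power series, as sequences of coefficients *)

Definition fps (R : Type) := nat -> R.

Definition fps_one (R : nzRingType) : fps R := fun n => (n == 0%N)%:R.

Definition fps_sub (R : nzRingType) (f g : fps R) : fps R := fun n => f n - g n.

Definition fps_mul (R : nzRingType) (f g : fps R) : fps R :=
  fun n => \sum_(i < n.+1) f i * g (n - i)%N.

(** [fps_inv_prefix f n] lists the first [n] coefficients of [1 / f]. *)
Fixpoint fps_inv_prefix (F : fieldType) (f : fps F) (n : nat) : seq F :=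
  if n is m.+1 then
    let s := fps_inv_prefix f m in
    rcons s ((f 0%N)^-1 * ((m == 0%N)%:R - \sum_(i < m) f (m - i)%N * s`_i))
  else [::].

Definition fps_inv (F : fieldType) (f : fps F) : fps F :=
  fun n => (fps_inv_prefix f n.+1)`_n.

Lemma fps_mulV (F : fieldType) (f : fps F) :
  f 0%N != 0 -> fps_mul f (fps_inv f) =1 fps_one F.
Proof.
move=> f0 n.
have sz k : size (fps_inv_prefix f k) = k.
  by elim: k => //= k IH; rewrite size_rcons IH.
have nthE k i : (i < k)%N -> (fps_inv_prefix f k)`_i = fps_inv f i.
  elim: k => // k IH; rewrite ltnS leq_eqVlt => /orP[/eqP-> // | lt_ik].
  by rewrite /= nth_rcons sz lt_ik IH.
rewrite /fps_mul /fps_one big_ord_recl subn0 /= /fps_inv /=.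
rewrite nth_rcons sz ltnn eqxx mulVKf //.
suff -> : \sum_(i < n) f (bump 0 i) * (fps_inv_prefix f (n - bump 0 i).+1)`_(n - bump 0 i)
    = \sum_(i < n) f (n - i)%N * (fps_inv_prefix f n)`_i by rewrite subrK.
rewrite (reindex_inj rev_ord_inj) /=; apply: eq_bigr => i _.
rewrite /bump add1n subnSK // subKn 1?ltnW //.
by rewrite nthE.
Qed.

Definition ogf (K : fieldType) (p : species K) : fps rat :=
  fun n => (\dim {:p 'I_n})%:R.

(* Main.v *)
From HB Require Import structures.
Require Import Defs.
From mathcomp Require Import all_boot all_order all_algebra.

Set Implicit Arguments.
Unset Strict Implicit.
Unset Printing Implicit Defensive.

Import Order.TTheory GRing.Theory Num.Theory.
Local Open Scope ring_scope.

(** Restrict the product and coproduct to decompositions of [{0, ..., k-1}] into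
    an initial segment and the final segment that follows it.  If a product along
    the cut at [j] is followed by a coproduct along the cut at [i <= j], then the
    block of the compatibility axiom formed by the elements that are [>= j] and
    [< i] is empty.  The braiding is therefore trivial, and [q] disappears: the
    spaces [h [k]] form a graded bialgebra with the compatibility of the case
    [q = 0].  Such a bialgebra is free on its primitive elements, so the
    coefficient of [x^n] in [1 - 1 / O_h] is the dimension of the space of
    primitive elements of degree [n], those killed by all the coproducts along
    cuts at [i] with [0 < i < n].

    Only the dimension count behind the freeness is carried out.  Let [F_j] be
    the space of those elements of [h [k]] killed by the coproducts along the
    cuts at [1, ..., j-1]; it is [init_ker k j] below, and [P_j = init_ker j j]
    is the primitive part of [h [j]].  The coproduct [Delta] along the cut at [j]
    has kernel [F_(j+1)] on [F_j], and it maps [F_j] onto the tensor product of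
    [P_j] and the space of the final segment ([Delta_init_ker]).  It maps into
    it by coassociativity.  It maps onto it because, for [x] in [P_j], the
    product of [x] and [y] lies in [F_j] ([Delta_mu_eq0]) and [Delta] sends it to
    the tensor of [x] and [y] ([Delta_mu_cut]).  Adding up the dimensions of the
    quotients [F_j / F_(j+1)], which start from [F_1 = h [k]] and end with
    [F_k = P_k], gives [dim_recursion]:
    [dim h [k] = sum_(0 < j < k) dim P_j * dim h [k-j] + dim P_k].
    Since [dim h [0] = 1], this recursion says that [1 - 1 / O_h] is the
    generating function of the [dim P_k] ([fps_inv_recursion]). *)

(** * Tensor products with a subspace *)

Lemma tprod_is_linearl (K : fieldType) (V W : vectType K) (w : W) :
  linear (fun v : V => tprod v w).
Proof. by case: (bilin_tprod V W). Qed.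

Lemma tprod_is_linearr (K : fieldType) (V W : vectType K) (v : V) :
  linear (fun w : W => tprod v w).
Proof. by case: (bilin_tprod V W). Qed.

HB.instance Definition _ (K : fieldType) (V W : vectType K) (v : V) :=
  GRing.isLinear.Build K W (tens V W) _ (@tprod K V W v)
    (tprod_is_linearr v).

Lemma tprodZl (K : fieldType) (V W : vectType K) a (v : V) (w : W) :
  tprod (a *: v) w = a *: tprod v w.
Proof. by case: (bilin_tprod V W) => /(_ w) l _; exact: (scalable_linear l). Qed.

Lemma tprod0l (K : fieldType) (V W : vectType K) (w : W) :
  tprod (0 : V) w = 0.
Proof. by rewrite -[0 in LHS](scale0r 0) tprodZl scale0r. Qed.

(** Bundling [tprod _ w] as an element of [Hom] lets [tens_ext] be applied to the
    left factor of a tensor product when that factor is itself a tensor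
    product. *)
Definition tprod_with (K : fieldType) (V W : vectType K) (w : W) :
    'Hom(V, tens V W) :=
  let gL := GRing.isLinear.Build K V (tens V W) _ _ (@tprod_is_linearl K V W w) in
  linfun (HB.pack (fun v : V => tprod v w) gL : {linear V -> tens V W}).

Lemma tprod_withE (K : fieldType) (V W : vectType K) (w : W) (v : V) :
  tprod_with V w v = tprod v w.
Proof. by rewrite lfunE. Qed.

Lemma tassocK (K : fieldType) (U V W : vectType K) :
  (tassoc_inv U V W \o tassoc U V W)%VF = \1%VF.
Proof.
apply: tens_ext => t w.
pose L := (tassoc_inv U V W \o tassoc U V W \o tprod_with (tens U V) w)%VF.
have LE : L = tprod_with (tens U V) w.
  apply: tens_ext => u v.
  by rewrite !comp_lfunE tprod_withE tassocE tassoc_invE.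
by have /lfunP/(_ t) := LE; rewrite !comp_lfunE tprod_withE => ->; rewrite lfunE.
Qed.

Lemma tunitrK (K : fieldType) (V : vectType K) :
  (tprod_with V (1 : K^o) \o tunitr V)%VF = \1%VF.
Proof.
apply: tens_ext => v a; rewrite comp_lfunE tprod_withE tunitrE tprodZl id_lfunE.
by rewrite -linearZ /= /GRing.scale /= mulr1.
Qed.

Lemma tunitlK (K : fieldType) (V : vectType K) :
  (linfun (tprod (1 : K^o) : V -> tens K^o V) \o tunitl V)%VF = \1%VF.
Proof.
apply: tens_ext => a v; rewrite comp_lfunE lfunE /= tunitlE linearZ id_lfunE /=.
by rewrite -tprodZl /GRing.scale /= mulr1.
Qed.

Lemma tmap_comp (K : fieldType) (V V' V'' W W' W'' : vectType K)
    (f : 'Hom(V, V')) (f' : 'Hom(V', V'')) (g : 'Hom(W, W')) (g' : 'Hom(W', W'')) :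
  (tmap f' g' \o tmap f g)%VF = tmap (f' \o f)%VF (g' \o g)%VF.
Proof. by apply: tens_ext => v w; rewrite comp_lfunE !tmapE !comp_lfunE. Qed.

Lemma tmap1 (K : fieldType) (V W : vectType K) :
  tmap (\1%VF : 'End(V)) (\1%VF : 'End(W)) = \1%VF.
Proof. by apply: tens_ext => v w; rewrite tmapE !id_lfunE. Qed.

Lemma tmiddleE (K : fieldType) (V1 V2 V3 V4 : vectType K) k
    (v1 : V1) (v2 : V2) (v3 : V3) (v4 : V4) :
  tmiddle V1 V4 (tswap k V2 V3) (tprod (tprod v1 v2) (tprod v3 v4))
    = k *: tprod (tprod v1 v3) (tprod v2 v4).
Proof.
rewrite !comp_lfunE tassocE tmapE !comp_lfunE tassoc_invE tmapE tswapE !id_lfunE.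
by rewrite tprodZl 3!linearZ /= tassocE tassoc_invE.
Qed.

Lemma dim_tens (K : fieldType) (V W : vectType K) :
  \dim {:tens V W} = (\dim {:V} * \dim {:W})%N.
Proof. by rewrite dimvf dim_matrix. Qed.

(** The coefficient of the [b]-th basis vector of [W] in a tensor, as an element
    of [V].  Membership in the tensor product of a subspace of [V] with [W] is
    tested slice by slice. *)
Definition tslice (K : fieldType) (V W : vectType K) (b : 'I_(\dim {:W})) :
    'Hom(tens V W, V) :=
  (tunitr V \o tmap \1 (linfun (coord (vbasis {:W}) b : W -> K^o)))%VF.

Lemma tsliceE (K : fieldType) (V W : vectType K) b (v : V) (w : W) :
  tslice V b (tprod v w) = coord (vbasis {:W}) b w *: v.
Proof. by rewrite comp_lfunE tmapE tunitrE !lfunE. Qed.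

Lemma tslice_tmap (K : fieldType) (V V' W : vectType K) (f : 'Hom(V, V'))
    (b : 'I_(\dim {:W})) (t : tens V W) :
  tslice V' b (tmap f \1 t) = f (tslice V b t).
Proof.
suff /lfunP/(_ t) : (tslice V' b \o tmap f \1 = f \o tslice V b)%VF.
  by rewrite [LHS]comp_lfunE => ->; rewrite [LHS]comp_lfunE.
apply: tens_ext => v w; rewrite [LHS]comp_lfunE tmapE [RHS]comp_lfunE !tsliceE.
by rewrite linearZ id_lfunE.
Qed.

Lemma tens_slice (K : fieldType) (V W : vectType K) (t : tens V W) :
  t = \sum_b tprod (tslice V b t) (vbasis {:W})`_b.
Proof.
pose L := \sum_(b < \dim {:W}) (tprod_with V (vbasis {:W})`_b \o tslice V b)%VF.
suff /lfunP/(_ t) : \1%VF = L.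
  rewrite id_lfunE sum_lfunE => {1}->.
  by apply: eq_bigr => b _; rewrite comp_lfunE tprod_withE.
apply: tens_ext => v w; rewrite id_lfunE sum_lfunE.
rewrite {1}(coord_vbasis (memvf w)) linear_sum; apply: eq_bigr => b _.
by rewrite comp_lfunE tprod_withE tsliceE linearZ tprodZl.
Qed.

(** The tensor product of a subspace [P] with [W] is represented as the range of
    this map. *)
Definition tincl (K : fieldType) (V W : vectType K) (P : {vspace V}) :
    'Hom(tens (subvs_of P) W, tens V W) :=
  tmap (linfun (vsval : subvs_of P -> V)) \1.

Lemma tinclE (K : fieldType) (V W : vectType K) (P : {vspace V})
    (v : subvs_of P) (w : W) : tincl W P (tprod v w) = tprod (vsval v) w.
Proof. by rewrite tmapE id_lfunE lfunE. Qed.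

(** A projection of [V] onto [P] induces a left inverse of [tincl W P], so no
    dimension is lost. *)
Lemma dim_tincl (K : fieldType) (V W : vectType K) (P : {vspace V}) :
  \dim (limg (tincl W P)) = (\dim P * \dim {:W})%N.
Proof.
rewrite limg_dim_eq; first by rewrite dim_tens dimvf.
apply/eqP; rewrite capfv; apply/lker0P/(can_inj (g := tmap (linfun (vsproj P)) \1)).
move=> t; rewrite -comp_lfunE tmap_comp comp_lfun1l -[RHS]id_lfunE -tmap1.
congr (tmap _ _ _); apply/lfunP => v.
by rewrite comp_lfunE !lfunE /= vsvalK.
Qed.

Lemma mem_tincl (K : fieldType) (V W : vectType K) (P : {vspace V})
    (t : tens V W) :
  (forall b, tslice V b t \in P) -> t \in limg (tincl W P).
Proof.
move=> tP; apply/memv_imgP.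
exists (\sum_b tprod (vsproj P (tslice V b t)) (vbasis {:W})`_b); rewrite ?memvf //.
rewrite linear_sum {1}[t]tens_slice; apply: eq_bigr => b _.
by rewrite /= tinclE vsprojK.
Qed.

(** * Dimensions along bijections *)

Lemma leq_dim_sp (K : fieldType) (p : species K) (I J : finType) :
  bij I J -> (\dim {:p I} <= \dim {:p J})%N.
Proof.
move=> s; have [t st ts] := bij_funP s.
pose t' : bij J I := Bij (Bijective ts st).
have id_bij : bijective (@id I) by exists id.
have sK : (sp_map p t' \o sp_map p s)%VF = \1%VF.
  by rewrite -(sp_map_comp p (u := Bij id_bij)) ?sp_map_id // => x /=; rewrite st.
rewrite -(limg_dim_eq (f := sp_map p s)) ?dimvS ?subvf //.
apply/eqP; rewrite capfv; apply/lker0P/(can_inj (g := sp_map p t')) => x.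
by rewrite -comp_lfunE sK id_lfunE.
Qed.

Lemma dim_sp_card (K : fieldType) (p : species K) (I J : finType) :
  #|I| = #|J| -> \dim {:p I} = \dim {:p J}.
Proof.
move=> IJ; pose f x := enum_val (cast_ord IJ (enum_rank x)).
pose g y := enum_val (cast_ord (esym IJ) (enum_rank y)).
have fK : cancel f g by move=> x; rewrite /f /g enum_valK cast_ordK enum_rankK.
have gK : cancel g f by move=> x; rewrite /f /g enum_valK cast_ordKV enum_rankK.
apply/eqP; rewrite eqn_leq; apply/andP; split; apply: leq_dim_sp.
  exact: Bij (Bijective fK gK).
exact: Bij (Bijective gK fK).
Qed.

Lemma dim_sp_subft (K : fieldType) (p : species K) (U : finType) (S : {set U}) :
  \dim {:p (subft S)} = \dim {:p 'I_#|S|}.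
Proof. by apply: dim_sp_card; rewrite card_sig card_ord; apply: eq_card. Qed.

(** * The coproduct of a product *)

Lemma decomp_set0r (U : finType) (S : {set U}) : is_decomp S S set0.
Proof. by rewrite /is_decomp setU0 eqxx -setI_eq0 setI0 eqxx. Qed.

Lemma decomp_set0l (U : finType) (S : {set U}) : is_decomp S set0 S.
Proof. by rewrite /is_decomp set0U eqxx -setI_eq0 set0I eqxx. Qed.

Lemma in_decomp (U : finType) (I S T : {set U}) (z : U) : is_decomp I S T ->
  ~~ ((z \in S) && (z \in T)) && ((z \in I) == (z \in S) || (z \in T)).
Proof.
by case/andP=> /eqP-> /disjoint_setI0/setP/(_ z); rewrite !inE eqxx andbT => ->.
Qed.

Section Hopf.

Context (K : fieldType) (q : K) (h : species K).
Context (m : sp_monoid h) (c : sp_comonoid h).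
Context (bim : q_bimonoid_axioms q m c) (hconn : sp_connected h).

Definition unit_vec (U : finType) : h (subft (set0 : {set U})) :=
  mon_iota m U (1 : K^o).

Lemma dim_sp_set0 (U : finType) : \dim {:h (subft (set0 : {set U}))} = 1%N.
Proof.
rewrite dim_sp_subft cards0 -hconn; apply: dim_sp_card.
by rewrite card_ord card_void.
Qed.

(** This is where connectedness enters: the unit axiom gives the composite in the
    other order, and a one-sided inverse between lines is two-sided. *)
Lemma iota_eps (U : finType) : (mon_iota m U \o com_eps c U)%VF = \1%VF.
Proof.
have eps1 : com_eps c U (unit_vec U) = 1.
  by rewrite -comp_lfunE (bim_eps_iota bim) id_lfunE.
have unit_neq0 : unit_vec U != 0.
  by apply: contra_eq_neq eps1 => ->; rewrite linear0 eq_sym oner_neq0.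
have span : (<[unit_vec U]> = {:h (subft (set0 : {set U}))})%VS.
  apply/eqP; rewrite -(dimv_leqif_eq (subvf _)).
  by rewrite dim_sp_set0 dim_vline unit_neq0.
apply/lfunP => x; have : x \in <[unit_vec U]>%VS by rewrite span memvf.
case/vlineP=> k ->; rewrite comp_lfunE linearZ /= eps1 id_lfunE.
by rewrite -linearZ.
Qed.

(** The counit axiom determines the coproduct only after [com_eps] is applied to
    the right factor; [iota_eps] shows that this loses nothing. *)
Lemma Delta_set0r (U : finType) (I : {set U}) (d : is_decomp I I set0) x :
  com_Delta c d x = tprod x (unit_vec U).
Proof.
pose t := tmap \1 (com_eps c U) (com_Delta c d x).
have tx : t = tprod x (1 : K^o).
  have := com_Delta_counitr c d => /lfunP/(_ x).
  rewrite !comp_lfunE id_lfunE -/t => <-.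
  by rewrite -tprod_withE -comp_lfunE tunitrK id_lfunE.
rewrite -[LHS]id_lfunE -tmap1 -(iota_eps U) -[X in tmap X]comp_lfun1l -tmap_comp.
by rewrite comp_lfunE -/t tx tmapE id_lfunE.
Qed.

Lemma Delta_set0l (U : finType) (I : {set U}) (d : is_decomp I set0 I) x :
  com_Delta c d x = tprod (unit_vec U) x.
Proof.
pose t := tmap (com_eps c U) \1 (com_Delta c d x).
have tx : t = tprod (1 : K^o) x.
  have := com_Delta_counitl c d => /lfunP/(_ x).
  rewrite !comp_lfunE id_lfunE -/t => <-.
  have /lfunP/(_ t) := tunitlK (h (subft I)).
  by rewrite comp_lfunE lfunE id_lfunE.
rewrite -[LHS]id_lfunE -tmap1 -(iota_eps U).
rewrite -[X in tmap _ X]comp_lfun1l -tmap_comp.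
by rewrite comp_lfunE -/t tx tmapE id_lfunE.
Qed.

Lemma mu_set0r (U : finType) (I : {set U}) (d : is_decomp I I set0) x :
  mon_mu m d (tprod x (unit_vec U)) = x.
Proof.
have /lfunP/(_ (tprod x (1 : K^o))) := mon_mu_unitr m d.
by rewrite comp_lfunE tmapE tunitrE id_lfunE scale1r.
Qed.

Lemma mu_set0l (U : finType) (I : {set U}) (d : is_decomp I set0 I) x :
  mon_mu m d (tprod (unit_vec U) x) = x.
Proof.
have /lfunP/(_ (tprod (1 : K^o) x)) := mon_mu_unitl m d.
by rewrite comp_lfunE tmapE tunitlE id_lfunE scale1r.
Qed.

(** In the compatibility axiom the four blocks are syntactic intersections.  The
    blocks are made variables here so that they can be replaced by equal sets,
    such as [set0], without casts between the spaces that depend on them. *)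
Lemma Delta_mu (U : finType) (I S T S' T' A B C D : {set U})
    (eA : A = S :&: S') (eB : B = S :&: T') (eC : C = T :&: S') (eD : D = T :&: T')
    (d : is_decomp I S T) (d' : is_decomp I S' T')
    (dAB : is_decomp S A B) (dCD : is_decomp T C D)
    (dAC : is_decomp S' A C) (dBD : is_decomp T' B D) :
  (com_Delta c d' \o mon_mu m d)%VF =
  (tmap (mon_mu m dAC) (mon_mu m dBD)
   \o (tmiddle _ _ (tswap (q ^+ (#|B| * #|C|)) _ _)
   \o tmap (com_Delta c dAB) (com_Delta c dCD)))%VF.
Proof. by subst; exact: (bim_compat bim). Qed.

(** Cutting where the product was formed.  Both off-diagonal blocks are empty, so
    each factor is only split off from and glued back to a unit, and the power
    of [q] is [q ^+ 0]. *)
Lemma Delta_mu_cut (U : finType) (I S T : {set U}) (d : is_decomp I S T) x y :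
  com_Delta c d (mon_mu m d (tprod x y)) = tprod x y.
Proof.
have ST : S :&: T = set0 by apply: disjoint_setI0; case/andP: d.
have TS : set0 = T :&: S by rewrite setIC ST.
have := Delta_mu (esym (setIid S)) (esym ST) TS (esym (setIid T)) d d
  (decomp_set0r S) (decomp_set0l T) (decomp_set0r S) (decomp_set0l T).
move=> /lfunP/(_ (tprod x y)); rewrite 3!comp_lfunE tmapE Delta_set0r Delta_set0l.
by rewrite tmiddleE cards0 expr0 scale1r tmapE mu_set0r mu_set0l.
Qed.

(** Cutting inside the left factor.  The block [T :&: S'] is empty, so
    the right factor is not cut and the coproduct factors through that of [x]
    along the same cut. *)
Lemma Delta_mu_eq0 (U : finType) (I S T S' T' B : {set U})
    (d : is_decomp I S T) (d' : is_decomp I S' T')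
    (dS : is_decomp S S' B) (dT' : is_decomp T' B T) x y :
  com_Delta c dS x = 0 -> com_Delta c d' (mon_mu m d (tprod x y)) = 0.
Proof.
move=> x0.
have eA : S' = S :&: S'.
  apply/setP=> z; move: (in_decomp z d) (in_decomp z dS); rewrite !inE.
  by case: (z \in S); case: (z \in S'); case: (z \in B).
have eB : B = S :&: T'.
  apply/setP=> z; move: (in_decomp z d) (in_decomp z dS) (in_decomp z dT').
  rewrite !inE.
  by case: (z \in S); case: (z \in T'); case: (z \in T);
    case: (z \in B); case: (z \in S').
have eC : set0 = T :&: S'.
  apply/setP=> z; move: (in_decomp z d) (in_decomp z dS); rewrite !inE.
  by case: (z \in S); case: (z \in S'); case: (z \in T); case: (z \in B).
have eD : T = T :&: T'.
  apply/setP=> z; move: (in_decomp z dT'); rewrite !inE.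
  by case: (z \in T); case: (z \in T'); case: (z \in B).
have /lfunP/(_ (tprod x y)) := Delta_mu eA eB eC eD d d'
  dS (decomp_set0l T) (decomp_set0r S') dT'.
by rewrite !comp_lfunE tmapE x0 tprod0l !linear0.
Qed.

(** * Filtration of the space of an initial segment *)

(** All the segments of length at most [n] are taken in the single ambient type
    ['I_n].  The primitive part of [h [j]] then occurs as the same space for every
    [k >= j], and coproducts never have to be transported along bijections. *)
Context (n : nat).

Definition seg (i j : nat) : {set 'I_n} := [set x : 'I_n | (i <= x < j)%N].

Lemma seg_decomp i j k :
  (i <= j)%N -> (j <= k)%N -> is_decomp (seg i k) (seg i j) (seg j k).
Proof.
move=> ij jk; rewrite /is_decomp -setI_eq0.
apply/andP; split; apply/eqP/setP => x; rewrite !inE; case: (ltnP x j) => xj.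
- by rewrite /= orbF andbT (leq_trans xj jk) andbT.
- by rewrite andbF /= (leq_trans ij xj).
- by rewrite andbF.
- by rewrite andbF.
Qed.

Lemma card_seg i j : (j <= n)%N -> #|seg i j| = (j - i)%N.
Proof.
move=> jn; rewrite -sum1dep_card -(big_mkord (fun x => (i <= x < j)%N) (fun=> 1%N)).
rewrite -(big_nat_widen 0 j n (fun x => i <= x)%N (fun=> 1%N) jn).
by rewrite -(big_nat_widenl i 0 j xpredT) // sum_nat_const_nat muln1.
Qed.

(** The cut [i] ranges over ['I_k.+1] because the decomposition exists only for
    [i <= k]. *)
Definition init_ker (k j : nat) : {vspace h (subft (seg 0 k))} :=
  (\bigcap_(i < k.+1 | (0 < i < j)%N)
     lker (com_Delta c (seg_decomp (leq0n i) (leq_ord i))))%VS.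

(** Quantifying over the proof [d] lets coproducts be compared without
    exhibiting the particular proof used in [init_ker]. *)
Lemma mem_init_ker k j x :
  x \in init_ker k j <->
  forall i (d : is_decomp (seg 0 k) (seg 0 i) (seg i k)),
    (0 < i < j)%N -> (i <= k)%N -> com_Delta c d x = 0.
Proof.
split=> [/subv_bigcapP xP i d ij ik | xP].
  have ik1 : (i < k.+1)%N by [].
  have := xP (Ordinal ik1) ij; rewrite -memvE memv_ker /= => /eqP.
  by rewrite (bool_irrelevance (seg_decomp _ _) d).
by apply/subv_bigcapP=> i ij; rewrite -memvE memv_ker xP // leq_ord.
Qed.

Lemma init_ker_full k : init_ker k 1 = fullv.
Proof.
apply/vspaceP=> x; rewrite memvf; apply/mem_init_ker => i d.
by case: i d => [|i] d; rewrite ?ltnn ?andbF.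
Qed.

Lemma init_kerS k j (d : is_decomp (seg 0 k) (seg 0 j) (seg j k)) :
  (0 < j)%N -> (j <= k)%N ->
  init_ker k j.+1 = (init_ker k j :&: lker (com_Delta c d))%VS.
Proof.
move=> j0 jk; apply/vspaceP=> x; apply/idP/memv_capP => [/mem_init_ker xP|[/mem_init_ker xP]].
  split; last by rewrite memv_ker xP // j0 leqnn.
  by apply/mem_init_ker => i di /andP[i0 ij]; apply: xP; rewrite i0 ltnW.
rewrite memv_ker => /eqP xj; apply/mem_init_ker => i di /andP[i0].
rewrite ltnS leq_eqVlt => /orP[/eqP ij|ij] ik; last by apply: xP; rewrite ?i0.
by subst i; rewrite (bool_irrelevance di d).
Qed.

(** Graded freeness in one degree: the elements whose first possibly nonzero cut
    is at [j] have as leading part an arbitrary tensor of a primitive element of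
    degree [j] and an element of degree [k - j]. *)
Lemma Delta_init_ker k j (d : is_decomp (seg 0 k) (seg 0 j) (seg j k)) :
  (j <= k)%N ->
  (com_Delta c d @: init_ker k j = limg (tincl (h (subft (seg j k))) (init_ker j j)))%VS.
Proof.
move=> jk; apply/eqP; rewrite eqEsubv; apply/andP; split; apply/subvP => t.
  case/memv_imgP=> x /mem_init_ker xP ->; apply: mem_tincl => b.
  apply/mem_init_ker => i d1 ij le_ij.
  have d2 : is_decomp (seg i k) (seg i j) (seg j k) by exact: seg_decomp.
  have d3 : is_decomp (seg 0 k) (seg 0 i) (seg i k).
    by apply: seg_decomp => //; apply: leq_trans jk.
  (* By coassociativity, cutting the left factor of [com_Delta c d x] at [i] is
     cutting [x] at [i] first, which gives 0. *)
  rewrite -tslice_tmap; set y := tmap _ _ _.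
  suff y0 : tassoc _ _ _ y = 0.
    by rewrite -[y]id_lfunE -tassocK comp_lfunE y0 !linear0.
  have /lfunP/(_ x) := com_Delta_coassoc c d1 d d2 d3.
  by rewrite !comp_lfunE (xP _ d3) ?(leq_trans le_ij) // linear0.
(* The product is a section of the coproduct along the same cut. *)
case/memv_imgP=> u _ ->; apply/memv_imgP.
exists (mon_mu m d (tincl _ (init_ker j j) u)); last first.
  rewrite -[RHS]comp_lfunE; suff -> : (com_Delta c d \o mon_mu m d)%VF = \1%VF.
    by rewrite id_lfunE.
  by apply: tens_ext => x y; rewrite comp_lfunE Delta_mu_cut id_lfunE.
apply/mem_init_ker => i d3 ij ik; rewrite -!comp_lfunE.
suff -> : (com_Delta c d3 \o mon_mu m d \o tincl _ (init_ker j j))%VF = 0.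
  by rewrite lfunE.
have le_ij : (i <= j)%N by case/andP: ij => _ /ltnW.
apply: tens_ext => x y; rewrite !comp_lfunE tinclE [RHS]lfunE /=.
pose d1 := seg_decomp (leq0n i) le_ij.
apply: (Delta_mu_eq0 (dS := d1) d d3 (seg_decomp le_ij jk)).
by have /mem_init_ker/(_ _ d1) := subvsP x; apply.
Qed.

Lemma dim_init_ker k j : (0 < j)%N -> (j <= k)%N ->
  \dim (init_ker k j) =
  (\dim (init_ker k j.+1) + \dim (init_ker j j) * \dim {:h (subft (seg j k))})%N.
Proof.
move=> j0 jk; have d := seg_decomp (leq0n j) jk.
by rewrite -dim_tincl -(Delta_init_ker d jk) (init_kerS d) // limg_ker_dim.
Qed.

Lemma dim_recursion k : (k < n)%N ->
  \dim {:h 'I_k.+1} =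
  (\sum_(i < k) \dim (init_ker i.+1 i.+1) * \dim {:h 'I_(k.+1 - i.+1)}
   + \dim (init_ker k.+1 k.+1))%N.
Proof.
move=> kn.
have dim_seg i : \dim {:h (subft (seg i k.+1))} = \dim {:h 'I_(k.+1 - i)}.
  by rewrite dim_sp_subft card_seg.
have -> : \dim {:h 'I_k.+1} = \dim (init_ker k.+1 1).
  by rewrite init_ker_full dim_seg subn0.
suff H l : (l <= k)%N -> \dim (init_ker k.+1 1) =
    (\sum_(i < l) \dim (init_ker i.+1 i.+1) * \dim {:h 'I_(k.+1 - i.+1)}
     + \dim (init_ker k.+1 l.+1))%N by exact: H.
elim: l => [|l IH] lk; first by rewrite big_ord0.
have lk' : (l.+1 <= k.+1)%N by exact: leqW.
rewrite (IH (ltnW lk)) big_ord_recr /= (dim_init_ker (ltn0Sn l) lk') dim_seg.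
by rewrite addnA addnAC.
Qed.

End Hopf.

(** * Inverse of a power series satisfying a convolution recursion *)

(** With [A] and [P] the generating functions of [a] and of [p] (without constant
    term), the recursion reads [A = 1 + P A], that is [1 / A = 1 - P].  It is
    assumed only up to degree [N], because the sequence [p] to which the lemma is
    applied depends on the ambient type ['I_N]. *)
Lemma fps_inv_recursion (F : fieldType) (a p : nat -> nat) (N : nat) :
  a 0%N = 1%N ->
  (forall k, (k < N)%N ->
     a k.+1 = (\sum_(i < k) p i.+1 * a (k.+1 - i.+1) + p k.+1)%N) ->
  forall k, (k < N)%N -> fps_inv (fun i => (a i)%:R : F) k.+1 = - (p k.+1)%:R.
Proof.
move=> a0 rec.
set f : fps F := fun i => (a i)%:R.
have f0 : f 0%N != 0 by rewrite /f a0 oner_neq0.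
have mulV k : \sum_(i < k.+1) f (k - i)%N * fps_inv f i = (k == 0%N)%:R.
  rewrite -[RHS](fps_mulV f0 k) /fps_mul (reindex_inj rev_ord_inj) /=.
  by apply: eq_bigr => i _; rewrite subSS subKn // -ltnS.
have g0 : fps_inv f 0%N = 1.
  by have := mulV 0%N; rewrite big_ord1 /f a0 mul1r.
elim/ltn_ind => k IH kN.
have f00 : f 0%N = 1 by rewrite /f a0.
have := mulV k.+1; rewrite big_ord_recl big_ord_recr /= g0 mulr1 subn0.
rewrite /bump !add1n subnn f00 mul1r.
have -> : \sum_(i < k) f (k.+1 - (1 + i))%N * fps_inv f (1 + i)%N
    = - (\sum_(i < k) p i.+1 * a (k.+1 - i.+1))%:R.
  rewrite natr_sum -sumrN; apply: eq_bigr => i _.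
  by rewrite add1n IH ?(ltn_trans _ kN) // mulrN natrM mulrC.
rewrite /f (rec k kN) natrD addrA [X in X + _]addrAC subrr add0r.
by move/eqP; rewrite addrC addr_eq0 => /eqP.
Qed.

Theorem theorem4p4 (K : fieldType) (q : K) (h : q_hopf_monoid q)
    (hconn : sp_connected h) (n : nat) :
  fps_sub (fps_one rat) (fps_inv (ogf h)) n \is a Num.nat.
Proof.
have h0 : \dim {:h 'I_0} = 1%N.
  by rewrite -hconn; apply: dim_sp_card; rewrite card_ord card_void.
rewrite /fps_sub /fps_one; case: n => [|n].
  have := @fps_mulV rat (ogf h); rewrite /ogf h0 oner_neq0 => /(_ isT 0%N).
  by rewrite /fps_mul big_ord1 h0 mul1r => ->; rewrite subrr.
pose p i := \dim (init_ker (hopf_comonoid h) n.+1 i i).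
rewrite (@fps_inv_recursion rat (fun i => \dim {:h 'I_i}) p n.+1) //; last first.
  exact: (dim_recursion (hopf_bimonoid h) hconn).
by rewrite sub0r opprK natr_nat.
Qed.
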